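(* Consider the convex problem of minimizing $f(x)$ over $x\in\mathbb{R}^d$ subject to $f_i(x)\le 0$ ($i=1,\dots,n$) and $h_i(x)=0$ ($i=1,\dots,p$), satisfying the assumptions in the context, and let $w_k=[x_k;\lambda_k]$ be the iterates of the method of weighted dual averages described in the context, started from $w_0=[x_0;\lambda_0]$ with $\lambda_0\ge 0$. Let $w^*=[x^*;\lambda^*]$ be as in the context. There exists a constant $L$ such that for all $k$ $$\|g(x_k)\|_2\le L,\qquad \|\overline{g}(x_k)\|_2\le L,\qquad \overline{f}(x_k)\le L\|x_k-x^*\|_2,\qquad \|G(w_k)\|_2\le L(2\|w_0-w^*\|_2+\lambda^*+3),$$ and, with such an $L$ and $C:=L(2\|w_0-w^*\|_2+\lambda^*+3)$, running the algorithm for $K$ iterations gives an output $\overline{x}_{K+1}$ with $$f(\overline{x}_{K+1})-f(x^* )\le \frac{C(\|w_0-w^*\|_2^2+1)}{2(K+1)}\left(\frac{1}{1+\sqrt3}+\sqrt{2K+1}\right)$$ and $$\overline{f}(\overline{x}_{K+1})\le \frac{C\left(4(\|w_0-w^*\|_2+1)^2+1\right)}{2(K+1)}\left(\frac{1}{1+\sqrt3}+\sqrt{2K+1}\right).$$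
   Context: Problem and assumptions. $f,f_1,\dots,f_n:\mathbb{R}^d\to\mathbb{R}$ are convex and $h_1,\dots,h_p:\mathbb{R}^d\to\mathbb{R}$ are affine (no differentiability or Lipschitz continuity is assumed). Slater's condition holds: there is $\hat x\in\mathbb{R}^d$ with $f_i(\hat x)<0$ for all $i=1,\dots,n$ and $h_i(\hat x)=0$ for all $i=1,\dots,p$. The problem has an optimal solution, denoted $x^*$. The Lagrangian is $\mathcal{L}(x,\mu,\theta)=f(x)+\sum_{i=1}^n\mu_if_i(x)+\sum_{i=1}^p\theta_ih_i(x)$ and the dual problem is $\max_{\mu\in\mathbb{R}^n_+,\theta\in\mathbb{R}^p}\min_{x\in\mathbb{R}^d}\mathcal{L}(x,\mu,\theta)$. Under these assumptions strong duality holds and a dual optimal solution exists; fix one, $(\mu^*,\theta^* )$, and set $\lambda^*:=\sum_{i=1}^n\mu_i^*+\sum_{i=1}^p|\theta_i^*|$ and $w^*:=[x^*;\lambda^*]\in\mathbb{R}^{d+1}$. Notation. $[a;b]$ denotes vertical concatenation of column vectors. $\overline{f}(x):=\max(f_1(x),\dots,f_n(x),|h_1(x)|,\dots,|h_p(x)|)$, and $F(x,\lambda):=f(x)+\lambda\overline{f}(x)$. For each $x$, $g(x)\in\partial f(x)$ and $\overline{g}(x)\in\partial\overline{f}(x)$ are chosen subgradients, where $\partial\overline f(x)$ is the convex hull of the union of the sets $\partial f_i(x)$ with $f_i(x)=\overline f(x)$ and $\partial|h_i(x)|$ with $|h_i(x)|=\overline f(x)$. For $w=[x;\lambda]$: $G_x(w):=g(x)+\lambda\overline{g}(x)$,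 $G_\lambda(w):=\overline{f}(x)$, $G(w):=[G_x(w);G_\lambda(w)]$. Method of weighted dual averages. Input $w_0=[x_0;\lambda_0]$ with $x_0\in\mathbb{R}^d$, $\lambda_0\ge0$; $s_0=0$, $\beta_0=1$. For $k=0,1,\dots,K-1$: $$s_{k+1}=s_k+\frac{[G_x(w_k);-G_\lambda(w_k)]}{\|G(w_k)\|_2},\quad w_{k+1}=[x_{k+1};\lambda_{k+1}]=w_0-\frac{s_{k+1}}{\beta_k},\quad \beta_{k+1}=\beta_k+\frac1{\beta_k}.$$ It is assumed that $\|G(w_k)\|_2\ne0$ for every iterate used. Running the algorithm for $K$ iterations generates $w_0,\dots,w_K$, and its output is $$\overline{x}_{K+1}=\left(\sum_{k=0}^K\frac1{\|G(w_k)\|_2}\right)^{-1}\sum_{k=0}^K\frac{x_k}{\|G(w_k)\|_2}.$$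
   Formalization: At least one equality constraint is assumed (p ≥ 1), so that f̄ ≥ 0; with p = 0 and f̄ = max f_i the claim fails (e.g. f = x², f_1 = x − 1). Inequality-only problems are covered by taking h_1 = 0, i.e. f̄ = max(f_i, 0). *)

(* Defs.v *)
From HB Require Import structures.
From mathcomp Require Import all_boot all_order all_algebra.
From mathcomp Require Import all_classical all_reals all_analysis.

Set Implicit Arguments.
Unset Strict Implicit.
Unset Printing Implicit Defensive.

Import Order.TTheory GRing.Theory Num.Theory.
Import numFieldNormedType.Exports.

Local Open Scope classical_set_scope.
Local Open Scope ring_scope.

(* The library norm `|x| on matrices is the sup norm, hence [norm2]. *)
Definition dotv (R : realType) (m : nat) (u v : 'cV[R]_m) : R :=
  \sum_(i < m) u i ord0 * v i ord0.

Definition norm2 (R : realType) (m : nat) (u : 'cV[R]_m) : R :=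
  Num.sqrt (\sum_(i < m) u i ord0 ^+ 2).

(* w = [x; l] *)
Definition vcat (R : realType) (d : nat) (x : 'cV[R]_d) (l : R) :
  'cV[R]_(d + 1) := col_mx x l%:M.

Definition xpart (R : realType) (d : nat) (w : 'cV[R]_(d + 1)) : 'cV[R]_d :=
  usubmx w.

Definition lpart (R : realType) (d : nat) (w : 'cV[R]_(d + 1)) : R :=
  dsubmx w ord0 ord0.

Definition affine_fun (R : realType) (d : nat) (h : 'cV[R]_d -> R) : Prop :=
  exists (a : 'cV[R]_d) (b : R), forall x, h x = dotv a x + b.

Definition subdifferential (R : realType) (d : nat)
    (f : 'cV[R]_d -> R) (x : 'cV[R]_d) : set 'cV[R]_d :=
  [set v | forall y, f x + dotv v (y - x) <= f y].

Definition convex_hull (R : realType) (d : nat) (A : set 'cV[R]_d) :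
  set 'cV[R]_d := smallest (@convex_set R 'cV[R]_d) A.

(* The maximum of a nonempty list of reals (0 for the empty list). *)
Definition seq_max (R : realType) (s : seq R) : R :=
  \big[Num.max/head 0 s]_(a <- s) a.

Section Problem.
Context {R : realType} {d n p : nat}.
Implicit Types (f : 'cV[R]_d -> R) (fi : 'I_n -> 'cV[R]_d -> R).
Implicit Types (h : 'I_p -> 'cV[R]_d -> R) (x : 'cV[R]_d).

Definition feasible fi h x : Prop :=
  (forall i, fi i x <= 0) /\ (forall j, h j x = 0).

Definition optimal_solution f fi h x : Prop :=
  feasible fi h x /\ forall y, feasible fi h y -> f x <= f y.

Definition slater fi h : Prop :=
  exists x, (forall i, fi i x < 0) /\ (forall j, h j x = 0).

Definition lagrangian f fi h x (mu : 'cV[R]_n) (theta : 'cV[R]_p) : R :=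
  f x + \sum_(i < n) mu i ord0 * fi i x + \sum_(j < p) theta j ord0 * h j x.

(* The dual objective is -oo where the Lagrangian is unbounded below in x. *)
Definition dual_function f fi h (mu : 'cV[R]_n) (theta : 'cV[R]_p) : \bar R :=
  ereal_inf (range (fun x => (lagrangian f fi h x mu theta)%:E)).

Definition dual_optimal f fi h (mu : 'cV[R]_n) (theta : 'cV[R]_p) : Prop :=
  (forall i, 0 <= mu i ord0) /\
  forall (mu' : 'cV[R]_n) (theta' : 'cV[R]_p), (forall i, 0 <= mu' i ord0) ->
    (dual_function f fi h mu' theta' <= dual_function f fi h mu theta)%E.

(* If 0 < p this is nonnegative because of the terms |h_j|, so the method never
   decreases lambda; problems with inequalities only are covered by p = 1 and
   h_0 = 0, which makes it max(f_i, 0). *)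
Definition fbar fi h x : R :=
  seq_max ([seq fi i x | i <- enum 'I_n] ++ [seq `|h j x| | j <- enum 'I_p]).

Definition fbar_subdifferential fi h x : set 'cV[R]_d :=
  convex_hull
    ((\bigcup_(i in [set i | fi i x = fbar fi h x])
        subdifferential (fi i) x) `|`
     (\bigcup_(j in [set j | `|h j x| = fbar fi h x])
        subdifferential (fun y => `|h j y|) x)).

End Problem.

Section Method.
Context {R : realType} {d : nat}.
Implicit Types (g gbar : 'cV[R]_d -> 'cV[R]_d) (fb : 'cV[R]_d -> R).
Implicit Types (w : 'cV[R]_(d + 1)).

Definition Gx g gbar w : 'cV[R]_d :=
  g (xpart w) + lpart w *: gbar (xpart w).

Definition Gl fb w : R := fb (xpart w).

Definition G g gbar fb w : 'cV[R]_(d + 1) := vcat (Gx g gbar w) (Gl fb w).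

(* The state (s_k, w_k, beta_k).  Once some G(w_k) vanishes, the values are
   junk (0^-1 = 0); see [used]. *)
Fixpoint wda_state g gbar fb w0 (k : nat) :
    'cV[R]_(d + 1) * 'cV[R]_(d + 1) * R :=
  if k is k'.+1 then
    let: (s, w, beta) := wda_state g gbar fb w0 k' in
    let s' := s + (norm2 (G g gbar fb w))^-1 *:
                    vcat (Gx g gbar w) (- Gl fb w) in
    (s', w0 - beta^-1 *: s', beta + beta^-1)
  else (0, w0, 1).

Definition wda g gbar fb w0 (k : nat) : 'cV[R]_(d + 1) :=
  (wda_state g gbar fb w0 k).1.2.

Definition used g gbar fb w0 (k : nat) : Prop :=
  forall j, (j <= k)%N -> norm2 (G g gbar fb (wda g gbar fb w0 j)) != 0.

Definition wda_output g gbar fb w0 (K : nat) : 'cV[R]_d :=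
  let c k := (norm2 (G g gbar fb (wda g gbar fb w0 k)))^-1 in
  (\sum_(k < K.+1) c k)^-1 *:
    \sum_(k < K.+1) c k *: xpart (wda g gbar fb w0 k).

End Method.

(* Main.v *)
(* Eliminating the constraints one at a time, each time by separating two sets
   of slopes on the real line, gives Lagrange multipliers under Slater's
   condition (first the inequalities over the affine set {h = 0}, where the
   Slater point is strictly feasible, then the equalities).  So the dual optimal
   pair attains f(x* ), and hence f + lambda* fbar >= f(x* ) everywhere.

   The regret of the normalized directions v_k against any u satisfies
     sum_(k <= K) <v_k, w_k - u>
       <= beta_K / 2 (1 + |w_0 - u|^2 - |w_(K+1) - u|^2),
   while its k-th term is at least (f(x_k) - f(x* ) + l fbar(x_k)) / |G(w_k)|
   for u = [x*; l].  The choice l = lambda* makes the left side nonnegative, so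
   the iterates stay within distance |w_0 - w*| + 1 of w*, where subgradients
   of finite convex functions are bounded; the same choice gives the bound on f,
   and l = lambda* + 1 the one on fbar. *)
Require Import Defs.
From HB Require Import structures.
From mathcomp Require Import all_boot all_order all_algebra.
From mathcomp Require Import all_classical all_reals all_analysis.
From mathcomp Require Import ring lra.

Set Implicit Arguments.
Unset Strict Implicit.
Unset Printing Implicit Defensive.

Import Order.TTheory GRing.Theory Num.Theory.
Import numFieldNormedType.Exports.

Local Open Scope classical_set_scope.
Local Open Scope ring_scope.

(** * Euclidean inner product and norm; concatenated vectors *)

Section Euclid.
Context {R : realType}.

Lemma dotvC m (u v : 'cV[R]_m) : dotv u v = dotv v u.
Proof. by apply: eq_bigr => i _; rewrite mulrC. Qed.

Lemma dotvDl m (u v w : 'cV[R]_m) : dotv (u + v) w = dotv u w + dotv v w.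
Proof. by rewrite -big_split; apply: eq_bigr => i _; rewrite mxE mulrDl. Qed.

Lemma dotvZl m a (u w : 'cV[R]_m) : dotv (a *: u) w = a * dotv u w.
Proof.
by rewrite /dotv mulr_sumr; apply: eq_bigr => i _; rewrite mxE mulrA.
Qed.

Lemma dotvDr m (u v w : 'cV[R]_m) : dotv w (u + v) = dotv w u + dotv w v.
Proof. by rewrite !(dotvC w) dotvDl. Qed.

Lemma dotvZr m a (u w : 'cV[R]_m) : dotv w (a *: u) = a * dotv w u.
Proof. by rewrite !(dotvC w) dotvZl. Qed.

Lemma dotvNl m (u w : 'cV[R]_m) : dotv (- u) w = - dotv u w.
Proof. by rewrite -scaleN1r dotvZl mulN1r. Qed.

Lemma dotvNr m (u w : 'cV[R]_m) : dotv w (- u) = - dotv w u.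
Proof. by rewrite !(dotvC w) dotvNl. Qed.

Lemma dotv0l m (w : 'cV[R]_m) : dotv 0 w = 0.
Proof. by rewrite -(scale0r 0) dotvZl mul0r. Qed.

Lemma dotv0r m (w : 'cV[R]_m) : dotv w 0 = 0.
Proof. by rewrite dotvC dotv0l. Qed.

Definition dotvE := (dotvDl, dotvDr, dotvNl, dotvNr, dotvZl, dotvZr).

Lemma dotv_suml m (I : Type) (s : seq I) (F : I -> 'cV[R]_m) w :
  dotv (\sum_(i <- s) F i) w = \sum_(i <- s) dotv (F i) w.
Proof.
by elim/big_rec2: _ => [|i a b _ <-]; rewrite ?dotv0l // dotvDl.
Qed.

Lemma dotv_ge0 m (u : 'cV[R]_m) : 0 <= dotv u u.
Proof. by apply: sumr_ge0 => i _; rewrite -expr2 sqr_ge0. Qed.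

Lemma norm2E m (u : 'cV[R]_m) : norm2 u = Num.sqrt (dotv u u).
Proof. by congr Num.sqrt; apply: eq_bigr => i _; rewrite expr2. Qed.

Lemma norm2_ge0 m (u : 'cV[R]_m) : 0 <= norm2 u.
Proof. exact: sqrtr_ge0. Qed.

Lemma sqr_norm2 m (u : 'cV[R]_m) : norm2 u ^+ 2 = dotv u u.
Proof. by rewrite norm2E sqr_sqrtr // dotv_ge0. Qed.

Lemma norm2N m (u : 'cV[R]_m) : norm2 (- u) = norm2 u.
Proof. by rewrite !norm2E !dotvE opprK. Qed.

Lemma norm2Z m a (u : 'cV[R]_m) : norm2 (a *: u) = `|a| * norm2 u.
Proof.
by rewrite !norm2E !dotvE mulrA -expr2 sqrtrM ?sqr_ge0 // sqrtr_sqr.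
Qed.

Lemma dotv_eq0 m (u v : 'cV[R]_m) : dotv u u = 0 -> dotv u v = 0.
Proof.
move=> u0; apply: big1 => i _; suff -> : u i ord0 = 0 by rewrite mul0r.
have /eqP := u0; rewrite psumr_eq0; last by move=> j _; rewrite -expr2 sqr_ge0.
by move=> /allP /(_ i (mem_index_enum i)) /=; rewrite mulf_eq0 orbb => /eqP.
Qed.

(** Cauchy-Schwarz: for nonzero norms, expand the squared length of [norm2 v *: u - norm2 u *: v],
    which is nonnegative, and divide by [norm2 u * norm2 v]. *)
Lemma dotv_le m (u v : 'cV[R]_m) : dotv u v <= norm2 u * norm2 v.
Proof.
have [u0|u0] := eqVneq (norm2 u) 0.
  by rewrite u0 mul0r dotv_eq0 // -sqr_norm2 u0 expr0n.
have [v0|v0] := eqVneq (norm2 v) 0.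
  by rewrite v0 mulr0 dotvC dotv_eq0 // -sqr_norm2 v0 expr0n.
have up : 0 < norm2 u by rewrite lt_neqAle eq_sym u0 norm2_ge0.
have vp : 0 < norm2 v by rewrite lt_neqAle eq_sym v0 norm2_ge0.
have := dotv_ge0 (norm2 v *: u - norm2 u *: v).
rewrite !dotvE (dotvC v u) -!sqr_norm2 => H.
rewrite -(ler_pM2l (mulr_gt0 up vp)); lra.
Qed.

Lemma norm2D m (u v : 'cV[R]_m) : norm2 (u + v) <= norm2 u + norm2 v.
Proof.
rewrite -ler_sqr ?nnegrE ?addr_ge0 ?norm2_ge0 // sqr_norm2 !dotvE (dotvC v u).
have := dotv_le u v; rewrite -!sqr_norm2 sqrrD; lra.
Qed.

Lemma coord_le_norm2 m (u : 'cV[R]_m) i : `|u i ord0| <= norm2 u.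
Proof.
rewrite -ler_sqr ?nnegrE ?normr_ge0 ?norm2_ge0 // sqr_norm2 /dotv (bigD1 i) //=.
rewrite real_normK ?num_real // -expr2 lerDl sumr_ge0 // => j _.
by rewrite -expr2 sqr_ge0.
Qed.

Lemma vcatK d (w : 'cV[R]_(d + 1)) : vcat (xpart w) (lpart w) = w.
Proof.
rewrite /vcat /xpart /lpart -[RHS]vsubmxK; congr col_mx.
by apply/matrixP => i j; rewrite !mxE !ord1 mulr1n.
Qed.

Lemma vcatB d (x y : 'cV[R]_d) a b : vcat x a - vcat y b = vcat (x - y) (a - b).
Proof. by rewrite /vcat opp_col_mx add_col_mx raddfB. Qed.

Lemma subr_vcat d (w : 'cV[R]_(d + 1)) y b :
  w - vcat y b = vcat (xpart w - y) (lpart w - b).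
Proof. by rewrite -vcatB vcatK. Qed.

Lemma xpart_vcat d (x : 'cV[R]_d) a : xpart (vcat x a) = x.
Proof. exact: col_mxKu. Qed.

Lemma lpart_vcat d (x : 'cV[R]_d) a : lpart (vcat x a) = a.
Proof. by rewrite /lpart col_mxKd mxE eqxx mulr1n. Qed.

Lemma dotv_vcat d (x y : 'cV[R]_d) a b :
  dotv (vcat x a) (vcat y b) = dotv x y + a * b.
Proof.
rewrite /dotv big_split_ord /= big_ord1 /vcat !col_mxEd !mxE eqxx !mulr1n.
by congr (_ + _); apply: eq_bigr => i _; rewrite !col_mxEu.
Qed.

Lemma sqr_norm2_vcat d (x : 'cV[R]_d) a :
  norm2 (vcat x a) ^+ 2 = norm2 x ^+ 2 + a ^+ 2.
Proof. by rewrite !sqr_norm2 dotv_vcat expr2. Qed.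

Lemma norm2_vcat_le d (x : 'cV[R]_d) a : norm2 (vcat x a) <= norm2 x + `|a|.
Proof.
rewrite -ler_sqr ?nnegrE ?addr_ge0 ?norm2_ge0 // sqr_norm2_vcat.
rewrite sqrrD real_normK ?num_real // lerD2r lerDl.
by rewrite mulrn_wge0 // mulr_ge0 ?norm2_ge0.
Qed.

Lemma norm2_xpart d (w : 'cV[R]_(d + 1)) : norm2 (xpart w) <= norm2 w.
Proof.
rewrite -[w in leRHS]vcatK -ler_sqr ?nnegrE ?norm2_ge0 // sqr_norm2_vcat.
by rewrite lerDl sqr_ge0.
Qed.

Lemma lpart_le_norm2 d (w : 'cV[R]_(d + 1)) : lpart w <= norm2 w.
Proof.
apply: le_trans (ler_norm _) _.
rewrite -[w in leRHS]vcatK -ler_sqr ?nnegrE ?norm2_ge0 // sqr_norm2_vcat.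
by rewrite real_normK ?num_real // lerDr sqr_ge0.
Qed.

End Euclid.

(** * Convex functions and affine maps *)

Section Convexity.
Context {R : realType} {V : lmodType R}.

(** The weight is a bare real with bounds, not an element of an interval type, so that it can be a
    computed quotient. *)
Definition jensen (F : V -> R) := forall t x y, 0 <= t <= 1 ->
  F (t *: x + (1 - t) *: y) <= t * F x + (1 - t) * F y.

Lemma convex_function_jensen (F : V -> R) :
  convex_function setT F -> jensen F.
Proof.
move=> cF t x y /andP[t0 t1].
by have := cF (Itv01 t0 t1) x y (in_setT _) (in_setT _).
Qed.

Lemma jensenD (F H : V -> R) : jensen F -> jensen H ->
  jensen (fun x => F x + H x).
Proof. move=> cF cH t x y t01 /=.
by have := cF t x y t01; have := cH t x y t01; lra. Qed.

Lemma jensenZ a (F : V -> R) : 0 <= a -> jensen F -> jensen (fun x => a * F x).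
Proof.
move=> a0 cF t x y t01 /=.
by apply: le_trans (ler_wpM2l a0 (cF t x y t01)) _; lra.
Qed.

Lemma jensen_sum n (mu : 'I_n -> R) (F : 'I_n -> V -> R) :
  (forall i, 0 <= mu i) -> (forall i, jensen (F i)) ->
  jensen (fun x => \sum_(i < n) mu i * F i x).
Proof.
move=> mu0 cF t x y t01; rewrite !mulr_sumr -big_split /=.
by apply: ler_sum => i _; exact: (jensenZ (mu0 i) (cF i)).
Qed.

Lemma jensen_le_max (F : V -> R) t x y : jensen F -> 0 <= t <= 1 ->
  F (t *: x + (1 - t) *: y) <= Num.max (F x) (F y).
Proof.
move=> cF t01; apply: le_trans (cF _ _ _ t01) _; case/andP: t01 => t0 t1.
have Fx : F x <= Num.max (F x) (F y) by rewrite le_max lexx.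
have Fy : F y <= Num.max (F x) (F y) by rewrite le_max lexx orbT.
move: (Num.max _ _) Fx Fy => M Fx Fy.
have := ler_wpM2l t0 Fx; have : 0 <= 1 - t by rewrite subr_ge0.
by move=> /ler_wpM2l /(_ _ _ Fy); lra.
Qed.

(** The weight [t] is unrestricted: [t = -1] gives the reflections used for equality constraints. *)
Definition affine_map (h : V -> R) := forall t x y,
  h (t *: x + (1 - t) *: y) = t * h x + (1 - t) * h y.

Lemma affine_jensen_norm (h : V -> R) :
  affine_map h -> jensen (fun x => `|h x|).
Proof.
move=> ah t x y /andP[t0 t1]; rewrite ah (le_trans (ler_normD _ _)) //.
by rewrite !normrM (ger0_norm t0) (@ger0_norm _ (1 - t)) // subr_ge0.
Qed.

End Convexity.

(** * Lagrange multipliers by separating slopes *)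

Section Multipliers.
Context {R : realType} {V : lmodType R}.
Implicit Types (X : V -> Prop) (F phi : V -> R).

Lemma real_separation (A B : set R) : A !=set0 -> B !=set0 ->
  (forall a b, A a -> B b -> a <= b) ->
  exists c, (forall a, A a -> a <= c) /\ (forall b, B b -> c <= b).
Proof.
move=> A0 [b0 Bb0] AB; exists (sup A); split=> [a Aa|b Bb].
  by apply: ub_le_sup => //; exists b0 => a' Aa'; exact: AB.
by apply: ge_sup => // a Aa; exact: AB.
Qed.

(** Some point of the segment between [x] and [y] makes the interpolated value of [phi] vanish.
    There [F] is at least [m], and convexity of [F] compares the two slopes. The condition speaks of
    the interpolated value only, so it serves both convex and affine [phi]. *)
Lemma slopes_ordered F phi m x y : jensen F -> 0 < phi x -> phi y < 0 ->
  (forall t, 0 <= t <= 1 -> t * phi x + (1 - t) * phi y = 0 ->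
     m <= F (t *: x + (1 - t) *: y)) ->
  (m - F x) / phi x <= (F y - m) / (- phi y).
Proof.
move=> cF px py Fm.
have D : 0 < phi x - phi y by rewrite subr_gt0 (lt_trans py).
pose t := - phi y / (phi x - phi y).
have tE : t * (phi x - phi y) = - phi y by rewrite divfK // gt_eqF.
have t01 : 0 <= t <= 1.
  by rewrite divr_ge0 ?(ltW D) ?oppr_ge0 ?(ltW py) //= ler_pdivrMr //; lra.
have t0 : t * phi x + (1 - t) * phi y = 0 by rewrite mulrBl; lra.
have H := le_trans (Fm t t01 t0) (cF _ _ _ t01).
rewrite ler_pdivrMr // mulrAC ler_pdivlMr ?oppr_gt0 //.
have := ler_wpM2l (ltW D) H.
have -> : (phi x - phi y) * (t * F x + (1 - t) * F y) =
  (t * (phi x - phi y)) * F x + (phi x - phi y - t * (phi x - phi y)) * F y.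
  by ring.
by rewrite tE; lra.
Qed.

(* The multiplier is a number separating the slopes of F against phi on
   phi > 0 from those on phi < 0. *)
Lemma inequality_multiplier X F phi m :
  (forall t x y, 0 <= t <= 1 -> X x -> X y -> X (t *: x + (1 - t) *: y)) ->
  jensen F -> jensen phi -> (exists x, X x /\ phi x < 0) ->
  (forall x, X x -> phi x <= 0 -> m <= F x) ->
  exists mu, 0 <= mu /\ forall x, X x -> m <= F x + mu * phi x.
Proof.
move=> cX cF cphi [xh [Xh ph]] Fm.
(* Including 0 in [A] forces the multiplier to be nonnegative and makes [A] nonempty; the strictly
   feasible point makes [B] nonempty. *)
pose A : set R := [set r | r = 0 \/
  exists x, [/\ X x, 0 < phi x & r = (m - F x) / phi x]].
pose B : set R := [set r |
  exists y, [/\ X y, phi y < 0 & r = (F y - m) / (- phi y)]].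
have [||a b [->|[x [Xx px ->]]] [y [Xy py ->]]|mu [Amu muB]] :=
    @real_separation A B.
- by exists 0; left.
- by exists ((F xh - m) / (- phi xh)), xh.
- by rewrite divr_ge0 ?subr_ge0 ?oppr_ge0 ?(ltW py) // Fm // ltW.
- apply: slopes_ordered => // t t01 t0; apply: Fm; first exact: cX.
  by rewrite -t0; exact: cphi.
exists mu; split; first by apply: Amu; left.
move=> x Xx; case: (ltgtP (phi x) 0) => [px|px|px].
- have /muB : B ((F x - m) / (- phi x)) by exists x.
  by rewrite ler_pdivlMr ?oppr_gt0 //; lra.
- have /Amu : A ((m - F x) / phi x) by right; exists x.
  by rewrite ler_pdivrMr //; lra.
- by rewrite px mulr0 addr0 Fm // px.
Qed.

(** The same separation, without 0 among the lower slopes, so the multiplier may have either sign.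
    Reflection through a zero of [phi] exchanges the two sides: either both slope sets are nonempty,
    or [phi] vanishes on [X] and the multiplier 0 works. *)
Lemma equality_multiplier X F phi m :
  (forall t x y, X x -> X y -> X (t *: x + (1 - t) *: y)) ->
  jensen F -> affine_map phi -> (exists x, X x /\ phi x = 0) ->
  (forall x, X x -> phi x = 0 -> m <= F x) ->
  exists theta, forall x, X x -> m <= F x + theta * phi x.
Proof.
move=> aX cF aphi [xh [Xh ph]] Fm.
have refl x : X x -> exists y, X y /\ phi y = - phi x.
  move=> Xx; exists ((- 1) *: x + (1 - (- 1)) *: xh); split; first exact: aX.
  by rewrite aphi ph; ring.
have [[z [Xz pz]]|none] := pselect (exists x, X x /\ 0 < phi x); last first.
  exists 0 => x Xx; rewrite mul0r addr0; apply: Fm => //.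
  apply/eqP; case: ltgtP => // px; last by case: none; exists x.
  have [y [Xy py]] := refl x Xx.
  by case: none; exists y; rewrite py oppr_gt0.
have [z' [Xz' pz']] := refl z Xz.
pose A : set R := [set r |
  exists x, [/\ X x, 0 < phi x & r = (m - F x) / phi x]].
pose B : set R := [set r |
  exists y, [/\ X y, phi y < 0 & r = (F y - m) / (- phi y)]].
have [||a b [x [Xx px ->]] [y [Xy py ->]]|theta [At tB]] :=
    @real_separation A B.
- by exists ((m - F z) / phi z), z.
- by exists ((F z' - m) / (- phi z')), z'; rewrite pz' oppr_lt0.
- apply: slopes_ordered => // t t01 t0.
  by apply: Fm; rewrite ?aphi //; exact: aX.
exists theta => x Xx; case: (ltgtP (phi x) 0) => [px|px|px].
- have /tB : B ((F x - m) / (- phi x)) by exists x.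
  by rewrite ler_pdivlMr ?oppr_gt0 //; lra.
- have /At : A ((m - F x) / phi x) by exists x.
  by rewrite ler_pdivrMr //; lra.
- by rewrite px mulr0 addr0 Fm.
Qed.

Definition ord_cons n (a : R) (u : 'I_n -> R) (i : 'I_n.+1) : R :=
  if unlift ord0 i is Some j then u j else a.

Lemma sum_ord_cons n a (u : 'I_n -> R) (F : 'I_n.+1 -> R) :
  \sum_i ord_cons a u i * F i = a * F ord0 + \sum_i u i * F (lift ord0 i).
Proof.
rewrite big_ord_recl {1}/ord_cons unlift_none; congr (_ + _).
by apply: eq_bigr => i _; rewrite /ord_cons liftK.
Qed.

(** Induction on the constraints: the first one gets its multiplier over the part of [X] where the
    others hold, and the product then joins the objective. The strictly feasible point survives in
    every such part. *)
Lemma inequality_multipliers n (fi : 'I_n -> V -> R) X F m :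
  (forall t x y, 0 <= t <= 1 -> X x -> X y -> X (t *: x + (1 - t) *: y)) ->
  jensen F -> (forall i, jensen (fi i)) ->
  (exists x, X x /\ forall i, fi i x < 0) ->
  (forall x, X x -> (forall i, fi i x <= 0) -> m <= F x) ->
  exists mu : 'I_n -> R, (forall i, 0 <= mu i) /\
    forall x, X x -> m <= F x + \sum_i mu i * fi i x.
Proof.
elim: n fi F => [|n IH] fi F cX cF cfi [xh [Xh fh]] Fm.
  exists (fun=> 0); split=> // x Xx; rewrite big_ord0 addr0; apply: Fm => //.
  by case.
pose X' x := X x /\ forall i, fi (lift ord0 i) x <= 0.
have [|||||a [a0 Fa]] := @inequality_multiplier X' F (fi ord0) m.
- move=> t x y t01 [Xx fx] [Xy fy]; split=> [|i]; first exact: cX.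
  have := cfi (lift ord0 i) t x y t01; case/andP: t01 => t0 t1.
  have t1' : 0 <= 1 - t by rewrite subr_ge0.
  have := mulr_ge0_le0 t0 (fx i); have := mulr_ge0_le0 t1' (fy i); lra.
- by [].
- exact: cfi.
- by exists xh; split=> //; split=> // i; exact: ltW.
- move=> x [Xx fx] f0; apply: Fm => // i.
  by case: (unliftP ord0 i) => [j|] ->.
have [|||||mu [mu0 Fmu]] :=
    IH (fun i => fi (lift ord0 i)) (fun x => F x + a * fi ord0 x).
- by [].
- by apply: jensenD => //; exact: jensenZ.
- by move=> i; exact: cfi.
- by exists xh.
- by move=> x Xx fx; apply: Fa.
exists (ord_cons a mu); split=> [i|x Xx].
  by rewrite /ord_cons; case: unlift.
by rewrite sum_ord_cons addrA Fmu.
Qed.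

(** The same induction; the sets stay closed under all affine combinations, as the reflections
    require. *)
Lemma equality_multipliers p (h : 'I_p -> V -> R) X F m :
  (forall t x y, X x -> X y -> X (t *: x + (1 - t) *: y)) ->
  jensen F -> (forall j, affine_map (h j)) ->
  (exists x, X x /\ forall j, h j x = 0) ->
  (forall x, X x -> (forall j, h j x = 0) -> m <= F x) ->
  exists theta : 'I_p -> R,
    forall x, X x -> m <= F x + \sum_j theta j * h j x.
Proof.
elim: p h F => [|p IH] h F aX cF ah [xh [Xh hh]] Fm.
  exists (fun=> 0) => x Xx; rewrite big_ord0 addr0; apply: Fm => //.
  by case.
pose X' x := X x /\ forall j, h (lift ord0 j) x = 0.
have [|||||a Fa] := @equality_multiplier X' F (h ord0) m.
- move=> t x y [Xx hx] [Xy hy]; split=> [|j]; first exact: aX.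
  by rewrite ah hx hy !mulr0 addr0.
- by [].
- exact: ah.
- by exists xh; split=> //; split.
- move=> x [Xx hx] h0; apply: Fm => // j.
  by case: (unliftP ord0 j) => [i|] ->.
have aa : jensen (fun x => a * h ord0 x).
  by move=> t x y _; rewrite ah; lra.
have [|||||theta Ft] :=
    IH (fun j => h (lift ord0 j)) (fun x => F x + a * h ord0 x).
- by [].
- exact: jensenD.
- by move=> j; exact: ah.
- by exists xh.
- by move=> x Xx hx; apply: Fa.
by exists (ord_cons a theta) => x Xx; rewrite sum_ord_cons addrA Ft.
Qed.

End Multipliers.

(** * Local boundedness of convex functions and of their subgradients *)

Section Subgradients.
Context {R : realType} {d : nat}.
Implicit Types (F : 'cV[R]_d -> R).

(* Halving splits off one coordinate at a time:
   y = (2 y' + 2 y_k e_k) / 2 with y' supported on the first k coordinates. *)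
Lemma jensen_bounded_box F r : jensen F -> 0 < r ->
  exists M, forall y : 'cV[R]_d, (forall i, `|y i ord0| <= r) -> F y <= M.
Proof.
move=> cF; suff H k : forall r, 0 < r -> exists M, forall y : 'cV[R]_d,
    (forall i, `|y i ord0| <= r) ->
    (forall i : 'I_d, (k <= i)%N -> y i ord0 = 0) -> F y <= M.
  move=> /(H d)[M FM]; exists M => y yr; apply: FM => // i.
  by rewrite leqNgt ltn_ord.
elim: k => [|k IH] {}r r0.
  exists (F 0) => y _ y0; suff -> : y = 0 by [].
  by apply/matrixP => i j; rewrite ord1 mxE y0.
have r20 : 0 < 2 * r by rewrite mulr_gt0.
have [M' FM'] := IH (2 * r) r20.
have [dk|kd] := leqP d k.
  exists M' => y yr y0; apply: FM' => // i.
    by apply: le_trans (yr i) _; rewrite ler_peMl ?ltW // ltr1n.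
  move=> ki; have := leq_ltn_trans (leq_trans dk ki) (ltn_ord i).
  by rewrite ltnn.
pose i0 := Ordinal kd; pose e : 'cV[R]_d := delta_mx i0 ord0.
(* [2 *: y'] lies in the doubled box, where [M'] is a bound, and [(2 * a) *: e] lies on the segment
   between the points [(2 * r) *: e] and [- (2 * r) *: e], where the values at the two ends bound
   [F]. *)
exists (Num.max M' (Num.max (F ((2 * r) *: e)) (F (- (2 * r) *: e)))).
move=> y yr y0.
pose a := y i0 ord0; pose y' := y - a *: e.
have yE : y = 2^-1 *: (2 *: y') + (1 - 2^-1) *: ((2 * a) *: e).
  rewrite !scalerA mulrA mulVf ?pnatr_eq0 // scale1r mulrBl mul1r.
  rewrite mulVf ?pnatr_eq0 //.
  by rewrite (_ : 2 - 1 = 1) ?mul1r ?subrK //; lra.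
rewrite [in F y]yE; apply: le_trans (jensen_le_max _ _ cF _) _.
  by rewrite invr_ge0 ler0n invf_le1 // ler1n.
have y'E i : y' i ord0 = if i == i0 then 0 else y i ord0.
  rewrite !mxE eqxx andbT; case: eqVneq => [->|_]; first by rewrite mulr1 subrr.
  by rewrite mulr0 subr0.
rewrite ge_max le_max FM' /= => [|i|i ki]; last 2 first.
- rewrite mxE normrM ger0_norm // ler_pM2l // y'E.
  by case: ifP => // _; rewrite normr0 ltW.
- rewrite mxE y'E; case: ifP => [|/eqP ni]; first by rewrite mulr0.
  rewrite y0 ?mulr0 // ltn_neqAle ki andbT.
  by apply/eqP => ik; case: ni; exact: val_inj.
have ar := yr i0; rewrite -/a ler_norml in ar; case/andP: ar => ar ra.
pose t := (a + r) / (2 * r).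
have tE : t * (2 * r) = a + r by rewrite divfK // gt_eqF.
have -> : (2 * a) *: e = t *: ((2 * r) *: e) + (1 - t) *: (- (2 * r) *: e).
  rewrite !scalerA -scalerDl; congr (_ *: _).
  have -> : t * (2 * r) + (1 - t) * - (2 * r) = 2 * (t * (2 * r)) - 2 * r.
    by ring.
  by rewrite tE; ring.
rewrite le_max (jensen_le_max _ _ cF) ?orbT //.
rewrite divr_ge0 ?(ltW r20) //=; last by lra.
by rewrite ler_pdivrMr // mul1r; lra.
Qed.

(** A unit step from [x] along [v] raises [F] by at least [norm2 v] and stays in the box of
    half-width [r + 1]. *)
Lemma subgradient_norm_le F v x r m M :
  subdifferential F x v -> norm2 x <= r -> m <= F x ->
  (forall y : 'cV[R]_d, (forall i, `|y i ord0| <= r + 1) -> F y <= M) ->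
  norm2 v <= M - m.
Proof.
move=> sv xr mF FM; have [v0|v0] := eqVneq (norm2 v) 0.
  rewrite v0 subr_ge0 (le_trans mF) // FM // => i.
  by rewrite (le_trans (coord_le_norm2 _ _)) // (le_trans xr) // lerDl.
have vp : 0 < norm2 v by rewrite lt_neqAle eq_sym v0 norm2_ge0.
pose y := x + (norm2 v)^-1 *: v.
have yr : F y <= M.
  apply: FM => i; rewrite (le_trans (coord_le_norm2 _ _)) //.
  rewrite (le_trans (norm2D _ _)) // lerD // norm2Z.
  by rewrite ger0_norm ?invr_ge0 ?norm2_ge0 // mulVf.
have := sv y; rewrite /y addrAC subrr add0r dotvZr -sqr_norm2 expr2 mulKf //.
by rewrite -/y; lra.
Qed.

(** Sum the subgradient inequalities at the weighted mean [a]; the linear terms cancel. *)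
Lemma subdifferential_average F v n (c : 'I_n -> R) (y : 'I_n -> 'cV[R]_d) :
  let S := \sum_i c i in let a := S^-1 *: \sum_i c i *: y i in
  S != 0 -> (forall i, 0 <= c i) -> subdifferential F a v ->
  S * F a <= \sum_i c i * F (y i).
Proof.
move=> S a S0 c0 sv.
have -> : S * F a = \sum_i c i * (F a + dotv v (y i - a)).
  have -> : \sum_i c i * (F a + dotv v (y i - a)) =
    \sum_i (c i * F a + (dotv (c i *: y i) v - c i * dotv a v)).
    by apply: eq_bigr => i _; rewrite !dotvE !(dotvC v); ring.
  rewrite big_split sumrB /= -dotv_suml -!mulr_suml -/S.
  suff -> : \sum_i c i *: y i = S *: a by rewrite dotvZl subrr addr0.
  by rewrite scalerA divff // scale1r.
by apply: ler_sum => i _; exact: ler_wpM2l.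
Qed.

End Subgradients.

(** * The constraint violation function [fbar] *)

Section Fbar.
Context {R : realType} {d n p : nat}.
Variables (fi : 'I_n -> 'cV[R]_d -> R) (h : 'I_p -> 'cV[R]_d -> R).
Hypothesis p_gt0 : (0 < p)%N.

Lemma seq_max_ge (s : seq R) a : a \in s -> a <= seq_max s.
Proof. by move=> sa; exact: le_bigmax_seq. Qed.

Lemma seq_max_le (s : seq R) b M :
  b \in s -> (forall a, a \in s -> a <= M) -> seq_max s <= M.
Proof.
case: s => // {}b s _ sM; rewrite /seq_max big_seq bigmax_le //.
by rewrite sM // mem_head.
Qed.

Lemma fi_le_fbar i x : fi i x <= fbar fi h x.
Proof. by apply: seq_max_ge; rewrite mem_cat map_f // mem_enum. Qed.

Lemma normh_le_fbar j x : `|h j x| <= fbar fi h x.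
Proof.
apply: seq_max_ge.
by rewrite mem_cat (map_f (fun j => `|h j x|)) ?mem_enum // orbT.
Qed.

Lemma fbar_ge0 x : 0 <= fbar fi h x.
Proof. exact: le_trans (normr_ge0 _) (normh_le_fbar (Ordinal p_gt0) x). Qed.

Lemma fbar_le M x : (forall i, fi i x <= M) -> (forall j, `|h j x| <= M) ->
  fbar fi h x <= M.
Proof.
move=> fM hM; apply: (@seq_max_le _ `|h (Ordinal p_gt0) x|) => [|a].
  by rewrite mem_cat (map_f (fun j => `|h j x|)) ?mem_enum // orbT.
by rewrite mem_cat => /orP[] /mapP[i _ ->].
Qed.

Lemma fbar_feasible x : feasible fi h x -> fbar fi h x = 0.
Proof.
move=> [fx hx]; apply/eqP; rewrite eq_le fbar_ge0 andbT.
by apply: fbar_le => // j; rewrite hx normr0.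
Qed.

(** An active function lies below [fbar] and agrees with it at [x], so its subgradients are
    subgradients of [fbar]; these form a convex set, which therefore contains the hull. *)
Lemma fbar_subdifferentialP x v :
  fbar_subdifferential fi h x v -> subdifferential (fbar fi h) x v.
Proof.
apply: smallest_sub => [a b l|{}v [[i /= ix sv]|[j /= jx sv]] y].
- rewrite !inE /subdifferential /= => Ha Hb y.
  have l0 : 0 <= l%:num by [].
  have l1 : 0 <= 1 - l%:num by rewrite subr_ge0.
  have := ler_wpM2l l0 (Ha y); have := ler_wpM2l l1 (Hb y).
  have -> : dotv (conv l a b) (y - x) =
    l%:num * dotv a (y - x) + (1 - l%:num) * dotv b (y - x).
    by rewrite -!dotvZl -dotvDl.
  by lra.
- by rewrite -ix (le_trans (sv y)) // fi_le_fbar.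
- by rewrite -jx (le_trans (sv y)) // normh_le_fbar.
Qed.

Lemma fbar_bounded_box r : (forall i, jensen (fi i)) ->
  (forall j, affine_map (h j)) -> 0 < r ->
  exists M, forall y : 'cV[R]_d,
    (forall i, `|y i ord0| <= r) -> fbar fi h y <= M.
Proof.
move=> cfi ah r0.
have [Mf fM] := choice (fun i => jensen_bounded_box (cfi i) r0).
have [Mh hM] :=
  choice (fun j => jensen_bounded_box (affine_jensen_norm (ah j)) r0).
(* The sum of the absolute values dominates each individual bound. *)
exists (\sum_i `|Mf i| + \sum_j `|Mh j|) => y yr; apply: fbar_le => [i|j].
  rewrite (le_trans (fM i y yr)) // (le_trans (ler_norm _)) //.
  by rewrite (bigD1 i) //= -addrA lerDl addr_ge0 ?sumr_ge0.
rewrite (le_trans (hM j y yr)) // (le_trans (ler_norm _)) //.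
by rewrite [X in _ + X](bigD1 j) //= addrCA lerDl addr_ge0 ?sumr_ge0.
Qed.

End Fbar.

(** * Growth of [beta] and the regret of dual averaging *)

Section DualAveraging.
Context {R : realType} (beta : nat -> R).
Hypotheses (beta0 : beta 0 = 1)
           (betaS : forall k, beta k.+1 = beta k + (beta k)^-1).

Lemma beta_ge1 k : 1 <= beta k.
Proof.
elim: k => [|k IH]; first by rewrite beta0.
by rewrite betaS (le_trans IH) // lerDl invr_ge0 (le_trans ler01).
Qed.

Lemma beta_gt0 k : 0 < beta k.
Proof. exact: lt_le_trans ltr01 (beta_ge1 k). Qed.

Lemma addV_le (x y : R) : 1 <= x -> x <= y -> x + x^-1 <= y + y^-1.
Proof.
move=> x1 xy; have x0 : 0 < x by exact: lt_le_trans x1.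
have y0 : 0 < y by exact: lt_le_trans xy.
have xy1 : 1 <= x * y by rewrite mulr_ege1 // (le_trans x1).
rewrite -subr_ge0.
have -> : y + y^-1 - (x + x^-1) = (y - x) * (x * y - 1) / (x * y).
  by field; rewrite !gt_eqF.
by rewrite divr_ge0 // mulr_ge0 ?subr_ge0 // ltW.
Qed.

(** Since [x + x^-1] increases for [x >= 1], the inductive step reduces to [(c + a)^-1 <= b - a] for
    consecutive square roots [a] and [b]. As [b - a = 2 / (a + b)], this says [b - a <= 2 * c],
    which holds because [a + b >= 1 + sqrt 3]; equality at the first step explains the constant
    [c]. *)
Lemma beta_le k : beta k <= (1 + Num.sqrt 3)^-1 + Num.sqrt (2 * k%:R + 1).
Proof.
set c := (1 + Num.sqrt 3)^-1.
have s0 : 0 <= Num.sqrt 3 :> R by exact: sqrtr_ge0.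
have s3 : Num.sqrt 3 ^+ 2 = 3 :> R by rewrite sqr_sqrtr.
have c0 : 0 < c by rewrite invr_gt0; lra.
have cE : c * (1 + Num.sqrt 3) = 1 by rewrite mulVf // gt_eqF //; lra.
elim: k => [|k IH]; first by rewrite beta0 mulr0 add0r sqrtr1; lra.
rewrite betaS (le_trans (addV_le (beta_ge1 k) IH)) //.
set a := Num.sqrt (2 * k%:R + 1); set b := Num.sqrt (2 * k.+1%:R + 1).
have k0 : 0 <= k%:R :> R by exact: ler0n.
have a1 : 1 <= a by rewrite -sqrtr1 ler_wsqrtr //; lra.
have b3 : Num.sqrt 3 <= b by rewrite ler_wsqrtr // -natr1; lra.
have a2 : a ^+ 2 = 2 * k%:R + 1 by rewrite sqr_sqrtr //; lra.
have b2 : b ^+ 2 = 2 * k%:R + 3 by rewrite sqr_sqrtr // -natr1; lra.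
have ab : (b - a) * (a + b) = 2.
  have -> : (b - a) * (a + b) = b ^+ 2 - a ^+ 2 by ring.
  by rewrite a2 b2; lra.
have ba : b - a <= 2 * c.
  have : (b - a) * (a + b) <= (2 * c) * (a + b).
    rewrite ab -[leLHS]mulr1 -cE mulrA ler_pM2l ?mulr_gt0 //; lra.
  by rewrite ler_pM2r //; lra.
rewrite -addrA lerD2l -lerBrDl invf_ple ?posrE; last 2 first.
- by rewrite addr_gt0 //; lra.
- by rewrite -(pmulr_lgt0 _ (_ : 0 < a + b)) ?ab //; lra.
have -> : (b - a)^-1 = (a + b) / 2.
  have ba0 : b - a != 0.
    by apply: contra_eq_neq ab => ->; rewrite mul0r eq_sym pnatr_eq0.
  by apply: (mulfI ba0); rewrite divff // mulrA ab divff.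
by lra.
Qed.

Variables (m : nat) (s w v : nat -> 'cV[R]_m) (w0 : 'cV[R]_m).
Hypotheses (s0 : s 0 = 0) (w00 : w 0 = w0).
Hypothesis sS : forall k, s k.+1 = s k + v k.
Hypothesis wS : forall k, w k.+1 = w0 - (beta k)^-1 *: s k.+1.

(** The right side is a potential. Expanding the square of [s K.+2 = s K.+1 + v K.+1], the cross
    term is the new summand, and the unit square of [v K.+1] costs [(beta K)^-1 / 2], exactly the
    growth of [beta / 2]. *)
Lemma dual_averaging_gap K : (forall k, (k <= K)%N -> norm2 (v k) = 1) ->
  \sum_(k < K.+1) dotv (v k) (w k - w0)
    <= beta K / 2 - (beta K)^-1 * norm2 (s K.+1) ^+ 2 / 2.
Proof.
elim: K => [|K IH] v1.
  rewrite big_ord1 w00 subrr dotv0r sS s0 add0r v1 // beta0 invr1; lra.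
rewrite big_ord_recr /= (le_trans (lerD (IH _) (lexx _))) => [//|k kK|].
  by rewrite v1 // leqW.
have sE : norm2 (s K.+2) ^+ 2 =
    norm2 (s K.+1) ^+ 2 + 2 * dotv (v K.+1) (s K.+1) + 1.
  have := sqr_norm2 (v K.+1); rewrite v1 // expr1n => v11.
  by rewrite (sS K.+1) sqr_norm2 !dotvE -sqr_norm2 -v11 (dotvC (s K.+1)); lra.
have -> : w K.+1 - w0 = - ((beta K)^-1 *: s K.+1).
  by rewrite wS addrAC subrr add0r.
rewrite dotvNr dotvZr.
have bb : (beta K.+1)^-1 <= (beta K)^-1.
  by rewrite lef_pV2 ?posrE ?beta_gt0 // betaS lerDl invr_ge0 ltW ?beta_gt0.
have := ler_wpM2r (sqr_ge0 (norm2 (s K.+2))) bb.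
have -> : beta K.+1 / 2 = beta K / 2 + (beta K)^-1 / 2 by rewrite betaS mulrDl.
by rewrite sE; lra.
Qed.

(** Split [w k - u] at [w0]: the directions sum to [s K.+1], and completing the square turns the
    terms in [s K.+1] into the distance from [w K.+1] to [u]. *)
Lemma dual_averaging_regret K u : (forall k, (k <= K)%N -> norm2 (v k) = 1) ->
  \sum_(k < K.+1) dotv (v k) (w k - u)
    <= beta K / 2 * (1 + norm2 (w0 - u) ^+ 2)
       - beta K / 2 * norm2 (w K.+1 - u) ^+ 2.
Proof.
move=> /dual_averaging_gap gap.
have -> : \sum_(k < K.+1) dotv (v k) (w k - u) =
  \sum_(k < K.+1) dotv (v k) (w k - w0) + dotv (s K.+1) (w0 - u).
  have -> : s K.+1 = \sum_(k < K.+1) v k.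
    elim: {gap}K => [|K IH]; first by rewrite sS s0 add0r big_ord1.
    by rewrite sS IH [RHS]big_ord_recr.
  rewrite dotv_suml -big_split /=; apply: eq_bigr => k _.
  by rewrite -dotvDr addrA subrK.
have -> : w K.+1 - u = (w0 - u) - (beta K)^-1 *: s K.+1 by rewrite wS addrAC.
have b0 := beta_gt0 K; move: (w0 - u) (s K.+1) gap => x y gap.
have -> : norm2 (x - (beta K)^-1 *: y) ^+ 2 = norm2 x ^+ 2
    - 2 * (beta K)^-1 * dotv y x + ((beta K)^-1) ^+ 2 * norm2 y ^+ 2.
  by rewrite !sqr_norm2 !dotvE (dotvC x y); ring.
have -> : beta K / 2 * (norm2 x ^+ 2 - 2 * (beta K)^-1 * dotv y x
    + ((beta K)^-1) ^+ 2 * norm2 y ^+ 2) =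
  beta K / 2 * norm2 x ^+ 2 - dotv y x + (beta K)^-1 * norm2 y ^+ 2 / 2.
  by field; rewrite gt_eqF.
by lra.
Qed.

End DualAveraging.

(** * Strong duality and the exact penalty inequality *)

Section Saddle.
Context {R : realType} {d n p : nat}.
Variables (f : 'cV[R]_d -> R) (fi : 'I_n -> 'cV[R]_d -> R).
Variables (h : 'I_p -> 'cV[R]_d -> R) (xstar : 'cV[R]_d).
Hypotheses (f_jensen : jensen f) (fi_jensen : forall i, jensen (fi i)).
Hypotheses (h_affine : forall j, affine_map (h j)) (slater_cond : slater fi h).
Hypothesis xstar_optimal : optimal_solution f fi h xstar.

Lemma lagrange_multipliers : exists (mu : 'cV[R]_n) (theta : 'cV[R]_p),
  (forall i, 0 <= mu i ord0) /\
  forall x, f xstar <= lagrangian f fi h x mu theta.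
Proof.
have [xh [fxh hxh]] := slater_cond; have [_ fmin] := xstar_optimal.
have [|||||mu [mu0 fmu]] := @inequality_multipliers _ _ _ fi
    (fun x => forall j, h j x = 0) f (f xstar).
- by move=> t x y _ hx hy j; rewrite h_affine hx hy !mulr0 addr0.
- by [].
- by [].
- by exists xh.
- by move=> x hx fx; apply: fmin; split.
have [|||||theta ftheta] := @equality_multipliers _ _ _ h (fun=> True)
    (fun x => f x + \sum_i mu i * fi i x) (f xstar).
- by [].
- by apply: jensenD => //; exact: jensen_sum.
- by [].
- by exists xh.
- by move=> x _; exact: fmu.
exists (\col_i mu i), (\col_j theta j); split=> [i|x]; first by rewrite mxE.
rewrite /lagrangian.
under eq_bigr do rewrite mxE.
under [X in _ <= _ + X]eq_bigr do rewrite mxE.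
exact: ftheta.
Qed.

Variables (mustar : 'cV[R]_n) (thetastar : 'cV[R]_p).
Hypothesis dual_opt : dual_optimal f fi h mustar thetastar.

(** The dual value at the optimal pair is at least the one at the multipliers just constructed,
    hence at least [f xstar]. *)
Lemma dual_optimal_lagrangian x :
  f xstar <= lagrangian f fi h x mustar thetastar.
Proof.
have [mu [theta [mu0 fL]]] := lagrange_multipliers.
have [_ /(_ mu theta mu0) le] := dual_opt.
rewrite -lee_fin; apply: le_trans (le_trans le _).
  by apply: le_ereal_inf_tmp => _ [y _ <-]; rewrite lee_fin.
by apply: ereal_inf_lbound; exists x.
Qed.

(** Each [fi i x] and each absolute value of [h j x] is at most [fbar fi h x], so the Lagrangian is
    bounded by the penalized objective. *)
Lemma penalty_saddle x : (0 < p)%N ->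
  f xstar <= f x + (\sum_i mustar i ord0 + \sum_j `|thetastar j ord0|)
                   * fbar fi h x.
Proof.
move=> p0; have [mu0 _] := dual_opt.
apply: le_trans (dual_optimal_lagrangian x) _.
rewrite /lagrangian -addrA lerD2l mulrDl !mulr_suml lerD // ler_sum // => i _.
  by rewrite ler_wpM2l // fi_le_fbar.
rewrite (le_trans (ler_norm _)) // normrM ler_wpM2l // normh_le_fbar //.
Qed.

End Saddle.

(** * Analysis of the iterates and of the weighted output *)

Section Method.
Context {R : realType} {d : nat}.
Variables (f fb : 'cV[R]_d -> R) (g gbar : 'cV[R]_d -> 'cV[R]_d).
Variables (w0 : 'cV[R]_(d + 1)).
Hypothesis fb_ge0 : forall x, 0 <= fb x.
Hypothesis w0_ge0 : 0 <= lpart w0.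

Let st k := wda_state g gbar fb w0 k.
Let s k := (st k).1.1.
Let w k := wda g gbar fb w0 k.
Let beta k := (st k).2.
Let v k :=
  (norm2 (G g gbar fb (w k)))^-1 *: vcat (Gx g gbar (w k)) (- Gl fb (w k)).

Lemma wda_betaS k : beta k.+1 = beta k + (beta k)^-1.
Proof. by rewrite /beta /st /=; case: wda_state => [[]]. Qed.

Lemma wda_sS k : s k.+1 = s k + v k.
Proof. by rewrite /v /w /wda /s /st /=; case: wda_state => [[]]. Qed.

Lemma wda_wS k : w k.+1 = w0 - (beta k)^-1 *: s k.+1.
Proof. by rewrite /w /wda /beta /s /st /=; case: wda_state => [[]]. Qed.

Lemma lpartD (a b : 'cV[R]_(d + 1)) : lpart (a + b) = lpart a + lpart b.
Proof. by rewrite /lpart !mxE. Qed.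

Lemma lpartZ c (a : 'cV[R]_(d + 1)) : lpart (c *: a) = c * lpart a.
Proof. by rewrite /lpart !mxE. Qed.

(** Every direction has last coordinate of the sign of [- fb], hence nonpositive, and [s] is
    subtracted from [w0]. Nonnegativity allows the subgradient inequality of [fb] to be scaled by
    the multiplier. *)
Lemma wda_lpart_ge0 k : 0 <= lpart (w k).
Proof.
have sl j : lpart (s j) <= 0.
  elim: j => [|j IH]; first by rewrite /lpart !mxE.
  rewrite wda_sS lpartD /v lpartZ lpart_vcat -(addr0 0) lerD //.
  by rewrite mulr_ge0_le0 ?oppr_le0 ?invr_ge0 ?norm2_ge0 //; exact: fb_ge0.
case: k => [//|k]; rewrite wda_wS lpartD -scaleN1r !lpartZ mulN1r.
rewrite subr_ge0 (le_trans _ w0_ge0) // mulr_ge0_le0 // invr_ge0 ltW //.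
exact: (beta_gt0 (erefl : beta 0 = 1) wda_betaS).
Qed.

Lemma norm2_direction k : norm2 (G g gbar fb (w k)) != 0 -> norm2 (v k) = 1.
Proof.
move=> G0; have -> : norm2 (v k) = (norm2 (G g gbar fb (w k)))^-1
    * norm2 (vcat (Gx g gbar (w k)) (- Gl fb (w k))).
  by rewrite norm2Z ger0_norm // invr_ge0 norm2_ge0.
suff -> : norm2 (vcat (Gx g gbar (w k)) (- Gl fb (w k))) =
    norm2 (G g gbar fb (w k)).
  by rewrite mulVf.
by rewrite !norm2E !dotv_vcat mulrNN.
Qed.

Variable xstar : 'cV[R]_d.
Hypothesis g_subgradient : forall x, subdifferential f x (g x).
Hypothesis gbar_subgradient : forall x, subdifferential fb x (gbar x).
Hypothesis fb_xstar : fb xstar = 0.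

(* Convex-concavity of F(x, lambda) = f x + lambda fb x turns the regret against
   [xstar; l] into the optimality gap penalized with weight l. *)
Lemma gap_le_dotv k l :
  f (xpart (w k)) - f xstar + l * fb (xpart (w k)) <=
  dotv (vcat (Gx g gbar (w k)) (- Gl fb (w k))) (w k - vcat xstar l).
Proof.
have := wda_lpart_ge0 k; rewrite subr_vcat dotv_vcat /Gx /Gl.
move: (xpart _) (lpart _) => x a a0.
have := g_subgradient x xstar; have := ler_wpM2l a0 (gbar_subgradient x xstar).
rewrite -(opprB x) !dotvE fb_xstar; lra.
Qed.

Definition weight k := (norm2 (G g gbar fb (w k)))^-1.

Lemma weighted_gap_le K l : used g gbar fb w0 K ->
  \sum_(k < K.+1) weight k * (f (xpart (w k)) - f xstar + l * fb (xpart (w k)))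
    <= beta K / 2 * (1 + norm2 (w0 - vcat xstar l) ^+ 2)
       - beta K / 2 * norm2 (w K.+1 - vcat xstar l) ^+ 2.
Proof.
move=> uK.
have /(_ (fun k kK => norm2_direction (uK k kK))) :=
  @dual_averaging_regret _ beta erefl wda_betaS _ s w v w0 erefl erefl
    wda_sS wda_wS K (vcat xstar l).
apply: le_trans; apply: ler_sum => k _.
by rewrite dotvZl ler_wpM2l ?gap_le_dotv // invr_ge0 norm2_ge0.
Qed.

Variable lambda : R.
Hypothesis lambda_ge0 : 0 <= lambda.
Hypothesis saddle : forall x, f xstar <= f x + lambda * fb x.

Let dist := norm2 (w0 - vcat xstar lambda).

(** With weight [lambda] the gaps are nonnegative, so the regret bound leaves a squared distance of
    at most [1 + dist ^+ 2], which is below [(dist + 1) ^+ 2]. *)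
Lemma iterate_dist k : used g gbar fb w0 k ->
  norm2 (w k - vcat xstar lambda) <= dist + 1.
Proof.
have D0 : 0 <= dist by exact: norm2_ge0.
case: k => [_|k uk]; first by rewrite lerDl.
have {}uk : used g gbar fb w0 k by move=> j jk; apply: uk; exact: leqW.
have b0 : 0 < beta k by exact: (beta_gt0 (erefl : beta 0 = 1) wda_betaS).
rewrite -ler_sqr ?nnegrE ?norm2_ge0 ?addr_ge0 //.
have : 0 <= \sum_(j < k.+1) weight j
    * (f (xpart (w j)) - f xstar + lambda * fb (xpart (w j))).
  apply: sumr_ge0 => j _; rewrite mulr_ge0 ?invr_ge0 ?norm2_ge0 //.
  by have := saddle (xpart (w j)); lra.
move=> /le_trans /(_ (weighted_gap_le lambda uk)).
rewrite -/dist subr_ge0 ler_pM2l ?divr_gt0 // => H.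
by rewrite (le_trans H) // sqrrD; lra.
Qed.

Lemma subgradients_bounded :
  (forall r, 0 < r -> exists M, forall y : 'cV[R]_d,
     (forall i, `|y i ord0| <= r) -> f y <= M) ->
  (forall r, 0 < r -> exists M, forall y : 'cV[R]_d,
     (forall i, `|y i ord0| <= r) -> fb y <= M) ->
  exists L, forall k, used g gbar fb w0 k ->
    [/\ norm2 (g (xpart (w k))) <= L,
        norm2 (gbar (xpart (w k))) <= L,
        fb (xpart (w k)) <= L * norm2 (xpart (w k) - xstar) &
        norm2 (G g gbar fb (w k)) <= L * (2 * dist + lambda + 3)].
Proof.
move=> bf bfb; have D0 : 0 <= dist by exact: norm2_ge0.
pose r := dist + 1 + norm2 xstar.
have r0 : 0 < r + 1 by rewrite ltr_wpDl // /r addr_ge0 ?norm2_ge0 // addr_ge0.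
have [M1 fM1] := bf _ r0; have [M2 fM2] := bfb _ r0.
(* Each entry is an upper bound on the enlarged box minus a lower bound near [xstar]: for [f] from
   its subgradient at [xstar], for [fb] simply 0. *)
pose L := Num.max (M1 - (f xstar - norm2 (g xstar) * (dist + 1))) M2.
exists L => k uk; set x := xpart (w k).
have xd : norm2 (x - xstar) <= dist + 1.
  apply: le_trans (iterate_dist uk).
  rewrite subr_vcat -[in leLHS](xpart_vcat (x - xstar) (lpart (w k) - lambda)).
  exact: norm2_xpart.
have xr : norm2 x <= r.
  by rewrite -[x](subrK xstar) (le_trans (norm2D _ _)) // lerD2r.
have fx : f xstar - norm2 (g xstar) * (dist + 1) <= f x.
  apply: le_trans (g_subgradient xstar x); rewrite lerD2l lerNl -dotvNr.
  by rewrite (le_trans (dotv_le _ _)) // norm2N ler_wpM2l ?norm2_ge0.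
have gL : norm2 (g x) <= L.
  by rewrite le_max (subgradient_norm_le (g_subgradient x) xr fx fM1).
have gbL : norm2 (gbar x) <= L.
  rewrite le_max -(subr0 M2).
  by rewrite (subgradient_norm_le (gbar_subgradient x) xr (fb_ge0 x) fM2) orbT.
have L0 : 0 <= L by exact: le_trans (norm2_ge0 _) gL.
have fbL : fb x <= L * norm2 (x - xstar).
  have := gbar_subgradient x xstar; rewrite fb_xstar -opprB dotvNr subr_le0.
  move=> /le_trans-> //; rewrite (le_trans (dotv_le _ _)) //.
  by rewrite ler_wpM2r ?norm2_ge0.
split=> //; rewrite (le_trans (norm2_vcat_le _ _)) // /Gx /Gl -/x.
have lw := wda_lpart_ge0 k.
have lL : lpart (w k) <= dist + 1 + lambda.
  rewrite -lerBlDr (le_trans _ (iterate_dist uk)) //.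
  rewrite (le_trans _ (lpart_le_norm2 _)) //.
  by rewrite subr_vcat lpart_vcat.
have A : norm2 (g x + lpart (w k) *: gbar x) <= L + (dist + 1 + lambda) * L.
  rewrite (le_trans (norm2D _ _)) // lerD // norm2Z ger0_norm //.
  by rewrite ler_pM ?norm2_ge0.
have B : `|fb x| <= L * (dist + 1).
  by rewrite ger0_norm // (le_trans fbL) // ler_wpM2l.
(* The total is [L + (dist + 1 + lambda) * L + L * (dist + 1)]. *)
lra.
Qed.

(** Convexity moves [F] inside the average, and each weight is at least [C^-1], so the total weight
    is at least [K.+1%:R / C]. *)
Lemma weighted_average_le (F : 'cV[R]_d -> R) C (B : R) K c :
  (forall x, exists u, subdifferential F x u) ->
  0 <= B -> used g gbar fb w0 K ->
  (forall k, (k <= K)%N -> norm2 (G g gbar fb (w k)) <= C) ->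
  \sum_(k < K.+1) weight k * (F (xpart (w k)) - c) <= B ->
  F (wda_output g gbar fb w0 K) - c <= C * B / K.+1%:R.
Proof.
move=> sF B0 uK GC sB; set xo := wda_output _ _ _ _ _.
have [u su] := sF xo.
have wp k : (k <= K)%N -> 0 < norm2 (G g gbar fb (w k)).
  by move=> kK; rewrite lt_neqAle eq_sym uK ?norm2_ge0.
have C0 : 0 < C by exact: lt_le_trans (wp 0%N isT) (GC 0%N isT).
pose S := \sum_(k < K.+1) weight k.
have SK : K.+1%:R / C <= S.
  have -> : K.+1%:R / C = \sum_(k < K.+1) C^-1.
    by rewrite sumr_const card_ord mulr_natl.
  apply: ler_sum => k _; have kK : (k <= K)%N by rewrite -ltnS.
  by rewrite lef_pV2 ?posrE ?wp ?GC.
have S0 : 0 < S by apply: lt_le_trans SK; rewrite divr_gt0 // ltr0n.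
have av : S * F xo <= \sum_(k < K.+1) weight k * F (xpart (w k)).
  apply: (@subdifferential_average _ _ F u K.+1 weight) su.
    by rewrite gt_eqF.
  by move=> k; rewrite invr_ge0 norm2_ge0.
have : S * (F xo - c) <= B.
  apply: le_trans sB; rewrite mulrBr.
  under [leRHS]eq_bigr do rewrite mulrBr.
  by rewrite sumrB -mulr_suml lerD2r.
rewrite mulrC -ler_pdivlMr // => /le_trans-> //.
rewrite [C * B]mulrC -mulrA ler_wpM2l //.
by rewrite -[C / _]invrK lef_pV2 ?posrE ?invf_div ?divr_gt0 ?ltr0n.
Qed.

Lemma rate_bounds C K : used g gbar fb w0 K ->
  (forall k, (k <= K)%N -> norm2 (G g gbar fb (w k)) <= C) ->
  let rate := (1 + Num.sqrt 3)^-1 + Num.sqrt (2 * K%:R + 1) in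
  f (wda_output g gbar fb w0 K) - f xstar <=
    C * (dist ^+ 2 + 1) / (2 * (K%:R + 1)) * rate /\
  fb (wda_output g gbar fb w0 K) <=
    C * (4 * (dist + 1) ^+ 2 + 1) / (2 * (K%:R + 1)) * rate.
Proof.
move=> uK GC rate; have D0 : 0 <= dist by exact: norm2_ge0.
have br : beta K <= rate by exact: (beta_le (erefl : beta 0 = 1) wda_betaS).
have b0 : 0 < beta K by exact: (beta_gt0 (erefl : beta 0 = 1) wda_betaS).
have w_ge0 k : 0 <= weight k by rewrite invr_ge0 norm2_ge0.
have gapB l : \sum_(k < K.+1) weight k
      * (f (xpart (w k)) - f xstar + l * fb (xpart (w k)))
    <= beta K / 2 * (1 + norm2 (w0 - vcat xstar l) ^+ 2).
  apply: le_trans (weighted_gap_le l uK) _; rewrite gerBl.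
  by rewrite mulr_ge0 ?sqr_ge0 // divr_ge0 // ltW.
have C0 : 0 <= C by exact: le_trans (norm2_ge0 _) (GC 0%N isT).
have rate_le (A B E : R) : 0 <= B -> B <= E ->
    A <= C * (beta K / 2 * B) / K.+1%:R ->
    A <= C * E / (2 * (K%:R + 1)) * rate.
  move=> B0 BE /le_trans; apply.
  have -> : C * (beta K / 2 * B) / K.+1%:R =
      C / (2 * (K%:R + 1)) * (B * beta K).
    by rewrite -natr1; field; rewrite natr1 pnatr_eq0.
  have -> : C * E / (2 * (K%:R + 1)) * rate = C / (2 * (K%:R + 1)) * (E * rate).
    by ring.
  rewrite ler_wpM2l ?divr_ge0 ?mulr_ge0 ?addr_ge0 ?ler0n //.
  by rewrite ler_pM // ltW.
split.
  apply: (rate_le _ (1 + dist ^+ 2)).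
  - by rewrite addr_ge0 ?sqr_ge0.
  - by rewrite addrC.
  apply: weighted_average_le => //.
  - by move=> x; exists (g x).
  - by rewrite mulr_ge0 ?divr_ge0 ?addr_ge0 ?sqr_ge0 // ltW.
  apply: le_trans (gapB lambda); apply: ler_sum => k _.
  by rewrite ler_wpM2l // lerDl mulr_ge0.
(* Weight lambda + 1 leaves one full copy of fb once the saddle inequality
   has absorbed the rest. *)
pose D1 := norm2 (w0 - vcat xstar (lambda + 1)).
(* Raising the weight by 1 moves the reference point by a vector of length 1. *)
have D1D : D1 <= dist + 1.
  have -> : D1 = norm2 ((w0 - vcat xstar lambda) + vcat (0 : 'cV[R]_d) (- 1)).
    have -> : vcat (0 : 'cV[R]_d) (- 1) =
        vcat xstar lambda - vcat xstar (lambda + 1).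
      by rewrite vcatB subrr opprD addrA subrr add0r.
    by rewrite addrA subrK.
  rewrite (le_trans (norm2D _ _)) // lerD2l.
  apply: le_trans (norm2_vcat_le _ _) _.
  by rewrite normrN normr1 norm2E dotv0l sqrtr0 add0r.
apply: (rate_le _ (1 + D1 ^+ 2)).
- by rewrite addr_ge0 ?sqr_ge0.
- have : D1 ^+ 2 <= (dist + 1) ^+ 2.
    by rewrite ler_sqr ?nnegrE ?norm2_ge0 ?addr_ge0.
  by have := sqr_ge0 (dist + 1); lra.
rewrite -[leLHS]subr0; apply: weighted_average_le => //.
- by move=> x; exists (gbar x).
- by rewrite mulr_ge0 ?divr_ge0 ?addr_ge0 ?sqr_ge0 // ltW.
apply: le_trans (gapB (lambda + 1)); apply: ler_sum => k _.
rewrite ler_wpM2l // subr0.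
by have := saddle (xpart (w k)); lra.
Qed.

End Method.

(** * Boundedness along the iterates and the convergence rates *)

Theorem theorem1 (R : realType) (d n p : nat)
  (f : 'cV[R]_d -> R) (fi : 'I_n -> 'cV[R]_d -> R) (h : 'I_p -> 'cV[R]_d -> R)
  (g gbar : 'cV[R]_d -> 'cV[R]_d)
  (xstar : 'cV[R]_d) (mustar : 'cV[R]_n) (thetastar : 'cV[R]_p)
  (x0 : 'cV[R]_d) (lambda0 : R)
  (p_gt0 : (0 < p)%N)
  (f_convex : convex_function setT f)
  (fi_convex : forall i, convex_function setT (fi i))
  (h_affine : forall j, affine_fun (h j))
  (slater_cond : slater fi h)
  (xstar_optimal : optimal_solution f fi h xstar)
  (dual_opt : dual_optimal f fi h mustar thetastar)
  (g_subgradient : forall x, subdifferential f x (g x))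
  (gbar_subgradient : forall x, fbar_subdifferential fi h x (gbar x))
  (lambda0_ge0 : 0 <= lambda0) :
  let fb := fbar fi h in
  let lambdastar := \sum_(i < n) mustar i ord0
                    + \sum_(j < p) `|thetastar j ord0| in
  let wstar := vcat xstar lambdastar in
  let w0 := vcat x0 lambda0 in
  let w := wda g gbar fb w0 in
  let x k := xpart (w k) in
  let xout := wda_output g gbar fb w0 in
  let dist := norm2 (w0 - wstar) in
  let C L := L * (2 * dist + lambdastar + 3) in
  let bounds L := forall k, used g gbar fb w0 k ->
    [/\ norm2 (g (x k)) <= L,
        norm2 (gbar (x k)) <= L,
        fb (x k) <= L * norm2 (x k - xstar) &
        norm2 (G g gbar fb (w k)) <= C L] in
  let rate (K : nat) := (1 + Num.sqrt 3)^-1 + Num.sqrt (2 * K%:R + 1) in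
  (exists L : R, bounds L) /\
  (forall L : R, bounds L -> forall K : nat, used g gbar fb w0 K ->
     f (xout K) - f xstar <=
       C L * (dist ^+ 2 + 1) / (2 * (K%:R + 1)) * rate K /\
     fb (xout K) <=
       C L * (4 * (dist + 1) ^+ 2 + 1) / (2 * (K%:R + 1)) * rate K).
Proof.
move=> fb lambdastar wstar w0 w x xout dist C bounds rate.
have cf := convex_function_jensen f_convex.
have cfi i := convex_function_jensen (fi_convex i).
have ah j : affine_map (h j).
  have [a [b hE]] := h_affine j => t y z.
  by rewrite !hE !dotvE; ring.
have fb0 y : 0 <= fb y by exact: fbar_ge0.
have w00 : 0 <= lpart w0 by rewrite lpart_vcat.
have sgb y : subdifferential fb y (gbar y).
  exact: fbar_subdifferentialP (gbar_subgradient y).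
have fbx : fb xstar = 0.
  by have [feas _] := xstar_optimal; exact: fbar_feasible.
have saddle y : f xstar <= f y + lambdastar * fb y.
  exact: (penalty_saddle cf cfi ah slater_cond xstar_optimal dual_opt).
have l0 : 0 <= lambdastar.
  by have [mu0 _] := dual_opt; rewrite addr_ge0 // sumr_ge0.
split.
  apply: (subgradients_bounded fb0 w00 g_subgradient sgb fbx saddle) => r r0.
    exact: jensen_bounded_box.
  exact: fbar_bounded_box.
move=> L bL K uK.
apply: (rate_bounds fb0 w00 g_subgradient sgb fbx l0 saddle uK) => k kK.
(* [bounds L] speaks of each [k] whose iterates up to [k] have nonzero [G]; for [k <= K] this
   follows from the assumption at [K]. *)
by have [] // := bL k (fun j jk => uK j (leq_trans jk kK)).
Qed.
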